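(* Let $\mathbb{V}$ be a real vector space of finite positive dimension, let $\kappa\in L^1_{\mathrm{loc}}(\mathbb{R})$ (complex-valued), and let $\phi:\mathbb{V}\to\mathbb{Z}$ be a PL-constructible function. (i) If $\mathrm{supp}(\phi)$ is compact, then $\mathrm{T}_\kappa[\phi]$ is continuous on $\mathbb{V}^*$. (ii) If $\mathrm{supp}(\phi)\subseteq K+C$ with $K$ convex compact and $C\ne\{0\}$ a non-empty closed convex cone, then (a) $\mathrm{T}_\kappa[\phi]$ is continuous on $\mathrm{Int}(C^\circ)$ when $\kappa\in L^1(\mathbb{R}_{\ge0})$, (b) $\mathrm{T}_\kappa[\phi]$ is continuous on $\mathrm{Int}(C^{a\circ})$ when $\kappa\in L^1(\mathbb{R}_{\le0})$.
   Context: A cone is a subset $C\subseteq\mathbb{V}$ with $\mathbb{R}_{>0}\cdot C\subseteq C$; $C^a=-C$; the polar is $C^\circ=\{\xi\in\mathbb{V}^*:\xi(C)\subseteq\mathbb{R}_{\ge0}\}$ and $C^{a\circ}=(C^a)^\circ$. A convex polyhedron is an intersection of finitely many open or closed affine half-spaces of $\mathbb{V}$. A function $\phi:\mathbb{V}\to\mathbb{Z}$ is PL-constructible if there is a finite partition $\mathbb{V}=\bigsqcup_{a\in A}P_a$ into convex polyhedra with $\phi$ constant on each $P_a$. **Euler calculus.** For a compactly supported function $\psi:X\to\mathbb{Z}$ on a real analytic manifold, constructible (i.e. with subanalytic level sets forming a locally finite family), write $\psi=\sum_i m_i\mathbf{1}_{K_i}$ (finite sum) with $m_i\in\mathbb{Z}$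 and $K_i$ compact contractible subanalytic, and set $\int_X\psi\,\mathrm{d}\chi=\sum_im_i$ (independent of the decomposition). For $\xi\in\mathbb{V}^*$ proper on $\mathrm{supp}(\phi)$, $\xi_*\phi(t)=\int_{\mathbb{V}}\mathbf{1}_{\xi^{-1}(t)}\cdot\phi\,\mathrm{d}\chi$, $t\in\mathbb{R}$. **Hybrid transform.** $\mathrm{T}_\kappa[\phi](\xi)=\int_{\mathbb{R}}\kappa(t)\,\xi_*\phi(t)\,\mathrm{d}t$, defined for those $\xi\in\mathbb{V}^*$ such that $\xi$ is proper on $\mathrm{supp}(\phi)$ and $\kappa\cdot\xi_*\phi\in L^1(\mathbb{R})$ (for compactly supported $\phi$: for all $\xi\in\mathbb{V}^*$). *)

(* Defs.v *)
From HB Require Import structures.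
From mathcomp Require Import all_boot all_order all_algebra.
From mathcomp Require Import all_classical all_reals all_analysis.
From mathcomp Require Import complex.

Set Implicit Arguments.
Unset Strict Implicit.
Unset Printing Implicit Defensive.

Import Order.TTheory GRing.Theory Num.Theory.
Import numFieldNormedType.Exports VectorInternalTheory.

Local Open Scope classical_set_scope.
Local Open Scope ring_scope.

(* A finite-dimensional real vector space with its canonical topology, the one
   that makes any (equivalently, every) linear coordinate system [v2r] a
   homeomorphism onto 'rV[R]_n.  It is convertible to [W], so that
   [A : set (fdtop W)] only selects a topology for [A : set W]. *)
Definition fdtop (R : realType) (W : vectType R) : Type :=
  initial_topology (@v2r R W).
HB.instance Definition _ (R : realType) (W : vectType R) :=
  Topological.on (fdtop W).

Section Subanalytic.
Context {R : realType}.

(* [f] is, near [a], the sum of an absolutely convergent power series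
   \sum_alpha c_alpha (x - a)^alpha; the sum is taken along the boxes
   {0, .., N - 1}^m of multi-indices. *)
Definition analytic_at m (f : 'rV[R]_m -> R) (a : 'rV[R]_m) : Prop :=
  exists c : {ffun 'I_m -> nat} -> R,
    let term (x : 'rV[R]_m) (alpha : {ffun 'I_m -> nat}) : R :=
      c alpha * \prod_(i < m) (x - a) ord0 i ^+ alpha i in
    \forall x \near a,
      summable setT (fun alpha => (term x alpha)%:E) /\
      (\sum_(alpha : {ffun 'I_m -> 'I_N})
         term x [ffun i => nat_of_ord (alpha i)]) @[N --> \oo] --> f x.

Definition semianalytic m (A : set 'rV[R]_m) : Prop :=
  forall a : 'rV[R]_m, exists2 U : set 'rV[R]_m, open_nbhs a U &
    exists (N p q : nat)
           (f : 'I_N -> 'I_p -> 'rV[R]_m -> R)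
           (g : 'I_N -> 'I_q -> 'rV[R]_m -> R),
      [/\ forall i j x, U x -> analytic_at (f i j) x,
          forall i k x, U x -> analytic_at (g i k) x &
          A `&` U =
          [set x | exists i, (forall j, f i j x = 0) /\
                             (forall k, 0 < g i k x)] `&` U].

(* Locally the projection of a relatively compact semianalytic set.  The
   auxiliary factor may be any real analytic manifold in the usual definition;
   by compactness, affine factors 'rV[R]_q suffice. *)
Definition subanalytic n (S : set 'rV[R]_n) : Prop :=
  forall a : 'rV[R]_n, exists2 U : set 'rV[R]_n, open_nbhs a U &
    exists (q : nat) (A : set 'rV[R]_(n + q)),
      [/\ semianalytic A, compact (closure A) & S `&` U = lsubmx @` A].

End Subanalytic.

Definition contractible (R : realType) (T : topologicalType) (K : set T) :
    Prop :=
  exists (p : T) (H : T * R -> T),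
    [/\ K p,
        {within K `*` `[0, 1]%classic, continuous H},
        forall x t, K x -> t \in `[0, 1] -> K (H (x, t)),
        forall x, K x -> H (x, 0) = x &
        forall x, K x -> H (x, 1) = p].

Section EulerCalculus.
Context {R : realType} (V : vectType R).
Local Notation V' := 'Hom(V, R^o).

Definition euler_sums (psi : V -> int) : set int :=
  [set s | exists (n : nat) (m : 'I_n -> int) (K : 'I_n -> set V),
     [/\ forall i, [/\ compact (K i : set (fdtop V)),
                       contractible R (K i : set (fdtop V)) &
                       subanalytic (v2r @` K i)],
         forall x, psi x = \sum_(i < n) m i * \1_(K i) x &
         s = \sum_(i < n) m i]].

(* The common value of \sum_i m_i over all the decompositions
   psi = \sum_i m_i 1_{K_i} (and 0 if there is no such value).  A function
   admitting a decomposition is automatically constructible with compact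
   support. *)
Definition euler_integral (psi : V -> int) : int :=
  xget 0 [set s | euler_sums psi = [set s]].

Definition supp (phi : V -> int) : set V :=
  closure ([set x | phi x != 0] : set (fdtop V)).

Definition proper_on (S : set V) (xi : V') : Prop :=
  forall B : set R, compact B ->
    compact (S `&` [set x | B (xi x)] : set (fdtop V)).

Definition pushforward (xi : V') (phi : V -> int) (t : R) : int :=
  euler_integral (fun x => \1_[set y | xi y = t] x * phi x).

End EulerCalculus.

Section ComplexIntegral.
Context {R : realType}.
Local Notation mu := (@lebesgue_measure R).

Definition clocally_integrable (f : R -> R[i]) : Prop :=
  locally_integrable setT (fun t => complex.Re (f t)) /\
  locally_integrable setT (fun t => complex.Im (f t)).

Definition cintegrable (D : set R) (f : R -> R[i]) : Prop :=
  mu.-integrable D (fun t => (complex.Re (f t))%:E) /\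
  mu.-integrable D (fun t => (complex.Im (f t))%:E).

Definition cintegral (f : R -> R[i]) : R[i] :=
  Complex (\int[mu]_t complex.Re (f t)) (\int[mu]_t complex.Im (f t)).

End ComplexIntegral.

Section HybridTransform.
Context {R : realType} (V : vectType R).
Local Notation V' := 'Hom(V, R^o).

Definition hybrid_integrand (kappa : R -> R[i]) (phi : V -> int) (xi : V')
    (t : R) : R[i] :=
  kappa t * (pushforward xi phi t)%:~R.

Definition hybrid_domain (kappa : R -> R[i]) (phi : V -> int) : set V' :=
  [set xi | proper_on (supp phi) xi /\
            cintegrable setT (hybrid_integrand kappa phi xi)].

(* Meaningful on [hybrid_domain kappa phi] only. *)
Definition hybrid_transform (kappa : R -> R[i]) (phi : V -> int) (xi : V') :
    R[i]^o :=
  cintegral (hybrid_integrand kappa phi xi).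

(* The i-th half-space is closed if [b i] holds and open otherwise. *)
Definition convex_polyhedron (P : set V) : Prop :=
  exists (n : nat) (xi : 'I_n -> V') (c : 'I_n -> R) (b : 'I_n -> bool),
    (forall i, xi i != 0) /\
    P = [set x | forall i, c i < (xi i x : R) ?<= if b i].

Definition PL_constructible (phi : V -> int) : Prop :=
  exists (n : nat) (P : 'I_n -> set V),
    [/\ forall a, convex_polyhedron (P a),
        partition setT P setT &
        forall a x y, P a x -> P a y -> phi x = phi y].

Definition cone (C : set V) : Prop :=
  forall (r : R) x, 0 < r -> C x -> C (r *: x).

Definition antipodal (C : set V) : set V := [set - x | x in C].

Definition polar (C : set V) : set V' :=
  [set xi | forall x, C x -> 0 <= (xi x : R)].

End HybridTransform.

(* Main.v *)
(** A PL-constructible function is an integer combination of indicator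
    functions of closed polyhedra, since the indicator of an open half-space is 1
    minus that of the opposite closed half-space.  Near a given covector xi0, the
    points of the support where |xi| <= n stay in a box independent of xi, so
    that for |t| <= n the pushforward at t is [\sum_k m_k 1_{xi(Q_k)}(t)] with
    compact convex polytopes Q_k and weights m_k that do not depend on n.  Hence
    the pushforwards are uniformly bounded and, for every t outside the countable
    set of extremal values of xi0 on these polytopes, constant in xi near xi0;
    dominated convergence concludes.  In (ii), the boxes exist because
    [xi x >= e |x|] on C, uniformly for xi near a point of the interior of the
    polar.

    The topological invariance of the Euler characteristic is not needed: if the
    total weight of a decomposition depended on the decomposition, then
    [euler_integral] would be identically 0; otherwise it is additive on the
    functions that have a decomposition. *)

Require Import Defs.
From HB Require Import structures.
From mathcomp Require Import all_boot all_order all_algebra.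
From mathcomp Require Import all_classical all_reals all_analysis.
From mathcomp Require Import complex.
From mathcomp Require Import ring lra measurable_realfun.

Set Implicit Arguments.
Unset Strict Implicit.
Unset Printing Implicit Defensive.

Import Order.TTheory GRing.Theory Num.Theory.
Import numFieldNormedType.Exports.

Local Open Scope classical_set_scope.
Local Open Scope ring_scope.

Lemma entry_le_norm (R : realType) n (u : 'rV[R]_n) i : `|u 0 i| <= `|u|.
Proof.
rewrite [leRHS]/Num.Def.normr/= mx_normrE.
by apply/bigmax_geP; right; exists (0, i).
Qed.

(** * Coordinates, norms and compactness in finite dimension *)

Section FiniteDimension.
Import VectorInternalTheory.
Context {R : realType} (V : vectType R).
Local Notation V' := 'Hom(V, R^o).

Lemma r2v_continuous : continuous (r2v : 'rV[R]_(dim V) -> fdtop V).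
Proof.
apply: continuous_comp_initial => x.
have -> : (v2r \o r2v : 'rV[R]_(dim V) -> _) = id.
  by apply/funext => y /=; rewrite r2vK.
exact: cvg_id.
Qed.

Lemma v2r_continuous : continuous (v2r : fdtop V -> 'rV[R]_(dim V)).
Proof. exact: initial_continuous. Qed.

(** Both coordinate maps are continuous, so neighbourhoods can be tested with the sup norm of
    coordinates. All later estimates, on [V] and on its dual, go through this criterion. *)
Lemma fdtop_nbhsP (x : V) (A : set V) :
  nbhs (x : fdtop V) A <->
  exists2 d : R, 0 < d & forall y, `|v2r y - v2r x| < d -> A y.
Proof.
split.
  move=> xA.
  have : nbhs (v2r x) (r2v @^-1` A).
    by have := @r2v_continuous (v2r x) A; rewrite v2rK => /(_ xA).
  move/nbhs_ballP => [d /= d0 dA]; exists d => // y yx.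
  by have := dA (v2r y); rewrite /= v2rK; apply; rewrite -ball_normE /= distrC.
move=> [d d0 dA].
have : nbhs (v2r x) (ball (v2r x) d) by exact: nbhsx_ballx.
move=> xd; have := @v2r_continuous x _ xd.
apply: (@filterS _ (nbhs (x : fdtop V)) (nbhs_filter (x : fdtop V))) => y /=.
by rewrite -ball_normE /= distrC => /dA.
Qed.

Lemma hom_sum_coord (xi : V') (y : 'rV[R]_(dim V)) :
  (xi (r2v y) : R) = \sum_i (xi (r2v (delta_mx 0 i)) : R) * y 0 i.
Proof.
rewrite [in LHS](row_sum_delta y) !linear_sum /=.
by apply: eq_bigr => i _; rewrite !linearZ /= /GRing.scale/= mulrC.
Qed.

(** Evaluation is bilinear, so its expansion in coordinates of both arguments bounds it. The
    constant is independent of [xi], which is what uniformity in the covector requires. *)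
Lemma hom_norm_bound : exists2 c : R, 0 < c &
  forall (xi : V') (x : V), `|xi x : R| <= c * `|v2r xi| * `|v2r x|.
Proof.
(* The matrix of the pairing between the two coordinate bases; 1 is added below for strict
   positivity. *)
pose c : R := \sum_i \sum_j
  `|(r2v (delta_mx 0 j) : V') (r2v (delta_mx 0 i : 'rV_(dim V))) : R|.
have c0 : 0 <= c by do 2![apply: sumr_ge0 => *].
exists (c + 1); first by rewrite ltr_wpDl.
move=> xi x.
suff : `|xi x : R| <= c * `|v2r xi| * `|v2r x|.
  move=> /le_trans; apply.
  by rewrite !mulrDl lerDl !mulr_ge0.
have -> : (xi x : R) = \sum_i \sum_j (v2r xi 0 j * v2r x 0 i) *
  ((r2v (delta_mx 0 j) : V') (r2v (delta_mx 0 i : 'rV_(dim V))) : R).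
  rewrite -[in LHS](v2rK x) hom_sum_coord; apply: eq_bigr => i _.
  rewrite -[in LHS](v2rK xi) [in LHS](row_sum_delta (v2r xi)) linear_sum /=.
  rewrite sum_lfunE mulr_suml; apply: eq_bigr => j _.
  by rewrite linearZ/= lfunE /= /GRing.scale /= mulrAC.
rewrite /c !mulr_suml; apply: le_trans (ler_norm_sum _ _ _) _.
apply: ler_sum => i _; rewrite !mulr_suml.
apply: le_trans (ler_norm_sum _ _ _) _.
apply: ler_sum => j _; rewrite !normrM -[leRHS]mulrA mulrC.
by apply: ler_wpM2l => //; rewrite ler_pM// entry_le_norm.
Qed.

Lemma hom_continuous (xi : V') : continuous (xi : fdtop V -> R).
Proof.
have [c c0 cP] := hom_norm_bound.
move=> x.
apply/(@cvgrPdist_lt _ _ _ (nbhs (x : fdtop V)) (nbhs_filter (x : fdtop V))).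
move=> e e0; apply/fdtop_nbhsP.
have k0 : 0 < c * (`|v2r xi| + 1) by rewrite mulr_gt0// ltr_wpDl.
exists (e / (c * (`|v2r xi| + 1))); first by rewrite divr_gt0.
move=> y; rewrite ltr_pdivlMr// => yx.
rewrite distrC -linearB (le_lt_trans (cP _ _))// (le_lt_trans _ yx)//.
rewrite linearB/= mulrC; apply: ler_wpM2l => //.
by apply: ler_wpM2l; [exact: ltW|rewrite lerDl].
Qed.

Lemma fdtop_compact_bounded (A : set V) : compact (A : set (fdtop V)) ->
  exists r : R, forall x, A x -> `|v2r x| <= r.
Proof.
move=> cA.
have := @continuous_compact _ _ (v2r : fdtop V -> _) A
  (continuous_subspaceT v2r_continuous) cA.
move=> /compact_bounded /pinfty_ex_gt0[r _ rP].
by exists r => x Ax; apply: rP; exists x.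
Qed.

(** Heine-Borel in the row space, carried over by the homeomorphism [r2v]. *)
Lemma fdtop_bounded_compact (A : set V) (r : R) :
  closed (A : set (fdtop V)) -> (forall x, A x -> `|v2r x| <= r) ->
  compact (A : set (fdtop V)).
Proof.
move=> clA Ar.
have : compact (r2v @^-1` A : set 'rV[R]_(dim V)).
  apply: bounded_closed_compact; last first.
    exact: (@preimage_closed 'rV[R]_(dim V) (fdtop V) r2v A
      (in1W r2v_continuous) clA).
  exists r; split; first exact: num_real.
  by move=> s rs x /Ar; rewrite r2vK => /le_trans; apply; exact: ltW.
move=> /(@continuous_compact _ _ (r2v : _ -> fdtop V) _
  (continuous_subspaceT r2v_continuous)).
congr compact; apply/seteqP; split => [x [y Ay <-]//|x Ax].
by exists (v2r x); rewrite /= v2rK.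
Qed.

End FiniteDimension.

(** * Analyticity of affine functions and semianalytic sets *)

Section Analytic.
Context {R : realType}.

Lemma analytic_at_monomial m (a : 'rV[R]_m) (v : R)
    (mono : {ffun 'I_m -> nat}) :
  analytic_at (fun x => v * \prod_(i < m) (x - a) ord0 i ^+ mono i) a.
Proof.
exists (fun alpha => v *+ (alpha == mono)) => /=.
apply: filterE => x; split.
  rewrite /summable (esumID [set mono])//.
  rewrite [X in (_ + X)%E](_ : _ = 0%E) ?adde0; last first.
    apply: esum1 => alpha [_ /= /eqP/negbTE ->].
    by rewrite mulr0n mul0r normr0.
  by rewrite setTI esum_set1// ltry.
(* The box of side [N] holds exponents up to [N - 1], so it contains [mono] once [N] exceeds every
   exponent; from then on the partial sums are constant. *)
apply: cvg_near_cst; exists (\max_(i < m) mono i).+1 => // -[//|N] /= mN.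
have monoN i : (mono i < N.+1)%N.
  by rewrite (leq_trans _ mN)// ltnS leq_bigmax.
rewrite (bigD1 [ffun i => Ordinal (monoN i)])//= [X in _ + X]big1 ?addr0.
  have -> : [ffun i => nat_of_ord ([ffun i0 => Ordinal (monoN i0)] i)] = mono.
    by apply/ffunP => i; rewrite !ffunE.
  by rewrite eqxx mulr1n.
move=> alpha alphaP; suff /negbTE -> : [ffun i => nat_of_ord (alpha i)] != mono
    by rewrite mulr0n mul0r.
apply: contra alphaP => /eqP alphaE; apply/eqP/ffunP => i.
by apply/val_inj; rewrite ffunE /= -alphaE ffunE.
Qed.

Lemma analytic_atD m (f g : 'rV[R]_m -> R) (a : 'rV[R]_m) :
  analytic_at f a -> analytic_at g a -> analytic_at (fun x => f x + g x) a.
Proof.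
move=> [c /= fc] [d /= gd]; exists (fun alpha => c alpha + d alpha) => /=.
near=> x.
have [fs fx] : summable setT (fun alpha =>
    (c alpha * \prod_(i < m) (x - a) ord0 i ^+ alpha i)%:E) /\
    (\sum_(alpha : {ffun 'I_m -> 'I_N})
      c [ffun i => nat_of_ord (alpha i)] * \prod_(i < m)
      (x - a) ord0 i ^+ [ffun i => nat_of_ord (alpha i)] i) @[N --> \oo] --> f x
  by near: x.
have [gs gx] : summable setT (fun alpha =>
    (d alpha * \prod_(i < m) (x - a) ord0 i ^+ alpha i)%:E) /\
    (\sum_(alpha : {ffun 'I_m -> 'I_N})
      d [ffun i => nat_of_ord (alpha i)] * \prod_(i < m)
      (x - a) ord0 i ^+ [ffun i => nat_of_ord (alpha i)] i) @[N --> \oo] --> g x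
  by near: x.
split.
  have := summableD fs gs; congr summable; apply/funext => alpha.
  by rewrite mulrDl EFinD.
under eq_fun do under eq_bigr do rewrite mulrDl.
under eq_fun do rewrite big_split.
exact: cvgD.
Unshelve. all: by end_near. Qed.

Lemma analytic_at_affine m (b : 'I_m -> R) (c : R) (a : 'rV[R]_m) :
  analytic_at (fun x => c + \sum_i b i * x ord0 i) a.
Proof.
(* Recentring at [a] leaves a constant and monomials of degree one in [x - a]. *)
have -> : (fun x : 'rV[R]_m => c + \sum_i b i * x ord0 i) =
    (fun x => (c + \sum_i b i * a ord0 i) + \sum_i b i * (x - a) ord0 i).
  apply/funext => x; rewrite -addrA -big_split /=; congr +%R.
  by apply: eq_bigr => i _; rewrite !mxE; ring.
have cst v : analytic_at (fun=> v) a.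
  have := analytic_at_monomial a v [ffun=> 0%N].
  under eq_fun do
    (rewrite big1 ?mulr1; last by move=> i _; rewrite ffunE expr0).
  by [].
apply: analytic_atD => //.
elim: (index_enum _) => [|i s IHs].
  by under eq_fun do rewrite big_nil.
under eq_fun do rewrite big_cons.
apply: analytic_atD => //.
have := analytic_at_monomial a (b i) [ffun j => nat_of_bool (j == i)].
congr analytic_at; apply/funext => x; congr *%R.
rewrite (bigD1 i)//= big1 ?mulr1 => [|j /negbTE ji].
  by rewrite ffunE eqxx expr1.
by rewrite ffunE ji expr0.
Qed.

Lemma semianalytic_affine m n (b : 'I_n -> 'I_m -> R) (c : 'I_n -> R) :
  semianalytic [set x : 'rV[R]_m |
    forall i, 0 <= c i + \sum_j b i j * x ord0 j].
Proof.
have cst v (x : 'rV[R]_m) : analytic_at (fun=> v) x.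
  have := analytic_at_affine (fun=> 0) v x.
  by under eq_fun do (rewrite big1 ?addr0; last by move=> j _; rewrite mul0r).
move=> a; exists setT; first by split => //; exact: openT.
pose f i (x : 'rV[R]_m) := c i + \sum_j b i j * x ord0 j.
pose s (k : 'I_#|{: {ffun 'I_n -> bool}}|) : {ffun 'I_n -> bool} := enum_val k.
(* Each piece of the union chooses [= 0] or [> 0] for every inequality. *)
exists #|{: {ffun 'I_n -> bool}}|, n, n.
(* The constants 0 here and 1 below fill the slot of the condition that is not chosen, making it
   hold trivially. *)
exists (fun k i => if s k i then f i else fun=> 0).
exists (fun k i => if s k i then fun=> 1 else f i).
split=> [k i x _|k i x _|].
- by case: (s k i) => //; exact: analytic_at_affine.
- by case: (s k i) => //; exact: analytic_at_affine.
congr (_ `&` _); apply/seteqP; split => x /=.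
  move=> fx; exists (enum_rank [ffun i => f i x == 0]).
  rewrite /s enum_rankK; split => i; rewrite ffunE; case: eqP => // /eqP fi0.
  by rewrite lt_neqAle eq_sym fi0/=; exact: fx.
move=> [k [f0 g0]] i; have := f0 i; have := g0 i.
by case: (s k i) => [_ fx0|fx0 _]; [rewrite [leRHS]fx0|exact: ltW].
Qed.

End Analytic.

(** * Closed polyhedra: convexity, contractibility, subanalyticity *)

Section Polyhedra.
Import VectorInternalTheory.
Context {R : realType} (V : vectType R).
Local Notation V' := 'Hom(V, R^o).

(** Encoding by lists turns intersection into concatenation. Zero covectors are allowed, and the set
    may be empty or unbounded. *)
Definition polyhedron (L : seq (V' * R)) : set V :=
  [set x : V | all (fun h : V' * R => h.2 <= (h.1 x : R)) L].

Lemma polyhedron_cat L1 L2 :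
  polyhedron (L1 ++ L2) = polyhedron L1 `&` polyhedron L2.
Proof.
apply/seteqP; split => x /=; rewrite /polyhedron/= all_cat; first by move/andP.
by move=> [] ->.
Qed.

Lemma polyhedron_closed L : closed (polyhedron L : set (fdtop V)).
Proof.
elim: L => [|h L IHL].
  have -> : polyhedron [::] = setT by apply/seteqP; split.
  exact: (@closedT (fdtop V)).
rewrite (_ : polyhedron (h :: L) =
    (h.1 : V -> R) @^-1` [set t | h.2 <= t] `&` polyhedron L).
  apply: (@closedI (fdtop V)) => //.
  by have := @preimage_closed (fdtop V) R h.1 [set t | h.2 <= t]
    (in1W (hom_continuous (xi := h.1))) (@closed_ge R h.2).
by apply/seteqP; split => x /andP.
Qed.

Lemma polyhedron_convex L x y (t : R) :
  t \in `[0, 1] -> polyhedron L x -> polyhedron L y ->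
  polyhedron L ((1 - t) *: x + t *: y).
Proof.
rewrite in_itv/= => /andP[t0 t1] /allP Lx /allP Ly; apply/allP => h hL.
rewrite linearD !linearZ /= /GRing.scale /=.
have -> : h.2 = (1 - t) * h.2 + t * h.2 by ring.
by rewrite lerD// ler_wpM2l ?subr_ge0 ?Lx ?Ly.
Qed.

(** By convexity, the straight-line homotopy to any chosen point stays inside. *)
Lemma polyhedron_contractible L : polyhedron L !=set0 ->
  contractible R (polyhedron L : set (fdtop V)).
Proof.
move=> [p Lp]; exists p, (fun z => (1 - z.2) *: (z.1 : V) + z.2 *: (p : V)).
split=> [//||x t Lx t01|x Lx|x Lx] /=.
- apply: continuous_subspaceT; apply: continuous_comp_initial => z.
  have -> : v2r \o (fun z : fdtop V * R =>
      (1 - z.2) *: (z.1 : V) + z.2 *: (p : V)) =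
      fun z => (1 - z.2) *: v2r (z.1 : V) + z.2 *: v2r p.
    by apply/funext => u /=; rewrite linearD !linearZ.
  have fstc : (v2r (u.1 : V) : 'rV[R]_(dim V)) @[u --> z] --> v2r (z.1 : V).
    by apply: (cvg_comp _ _ cvg_fst); exact: v2r_continuous.
  have sndc : u.2 @[u --> z] --> z.2 by exact: cvg_snd.
  apply: cvgD; last by apply: cvgZr_tmp.
  by apply: cvgZ => //; apply: cvgB => //; exact: cvg_cst.
- exact: polyhedron_convex.
- by rewrite subr0 scale1r scale0r addr0.
- by rewrite subrr scale0r scale1r add0r.
Qed.

Lemma polyhedron_subanalytic L : compact (polyhedron L : set (fdtop V)) ->
  subanalytic (v2r @` polyhedron L).
Proof.
move=> cL a; exists setT; first by split => //; exact: openT.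
(* In coordinates the polyhedron is already semianalytic, so the auxiliary factor has dimension 0
   and [lsubmx] merely identifies the two row spaces. *)
exists 0%N, [set z | polyhedron L (r2v (lsubmx z))]; split.
- have := @semianalytic_affine R (dim V + 0) (size L)
    (fun i j => match fintype.split j with
     | inl j' => ((nth (0, 0) L i).1 (r2v (delta_mx 0 j')) : R)
     | inr _ => 0 end) (fun i => - (nth (0, 0) L i).2).
  congr semianalytic.
  have zE (z : 'rV[R]_(dim V + 0)) (i : 'I_(size L)) :
    - (nth (0, 0) L i).2 + \sum_j (match fintype.split j with
     | inl j' => ((nth (0, 0) L i).1 (r2v (delta_mx 0 j')) : R)
     | inr _ => 0 end) * z 0 j =
    (nth (0, 0) L i).1 (r2v (lsubmx z)) - (nth (0, 0) L i).2.
    rewrite addrC; congr (_ - _); rewrite hom_sum_coord big_split_ord /=.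
    rewrite [X in _ + X]big_ord0 addr0; apply: eq_bigr => j _.
    by rewrite (fintype.unsplitK (inl j)) mxE.
  apply/seteqP; split => z /=.
    move=> zL; apply/(all_nthP (0, 0)) => i iL.
    by have := zL (Ordinal iL); rewrite zE subr_ge0.
  by move=> /(all_nthP (0, 0)) zL i; rewrite zE subr_ge0; exact: zL.
(* The right block is empty, so [lsubmx] is an isometry; closedness and boundedness transfer along
   it. *)
- have lsub_norm (z : 'rV[R]_(dim V + 0)) : `|z| = `|lsubmx z|.
    rewrite /Num.Def.normr/= !mx_normrE; apply/le_anti/andP; split.
      apply/bigmax_leP; split; first exact: bigmax_ge_id.
      move=> [i j] _ /=; rewrite -(fintype.splitK j).
      case: (fintype.split j) => [k|[]//].
      by apply/bigmax_geP; right; exists (i, k) => //=; rewrite mxE.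
    apply/bigmax_leP; split; first exact: bigmax_ge_id.
    move=> [i j] _ /=; rewrite mxE.
    by apply/bigmax_geP; right; exists (i, lshift 0 j).
  have lsub_cont : continuous (fun z : 'rV[R]_(dim V + 0) => lsubmx z).
    move=> z; apply/(@cvgrPdist_lt _ _ _ (nbhs z) (nbhs_filter z)) => e e0.
    apply/nbhs_ballP; exists e => // y; rewrite -ball_normE /=.
    by rewrite -linearB lsub_norm.
  have clL : closed
      [set z : 'rV[R]_(dim V + 0) | polyhedron L (r2v (lsubmx z))].
    have rlc : continuous ((r2v : 'rV[R]_(dim V) -> fdtop V) \o
        (fun z : 'rV[R]_(dim V + 0) => lsubmx z)).
      move=> z; exact: (@continuous_comp 'rV[R]_(dim V + 0) 'rV[R]_(dim V)
        (fdtop V) (fun z => lsubmx z) r2v z (@lsub_cont z)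
        (@r2v_continuous _ _ (lsubmx z))).
    by have := @preimage_closed _ (fdtop V) _ (polyhedron L) (in1W rlc)
      (@polyhedron_closed L).
  rewrite -(closure_id _).1//; apply: bounded_closed_compact => //.
  have [r Lr] := fdtop_compact_bounded cL.
  exists r; split; first exact: num_real.
  move=> s rs z /= /Lr; rewrite r2vK -lsub_norm => /le_trans; apply.
  exact: ltW.
- rewrite setIT; apply/seteqP; split => [_ [x Lx <-]|_ [z Lz <-]].
    by exists (row_mx (v2r x) 0); rewrite /= row_mxKl ?v2rK.
  by exists (r2v (lsubmx z)) => //; rewrite r2vK.
Qed.

End Polyhedra.

(** * Euler integrals of combinations of polyhedra *)

Section EulerSums.
Context {R : realType} (V : vectType R).
Local Notation V' := 'Hom(V, R^o).
Implicit Types (psi : V -> int) (L : seq (V' * R)).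

Lemma euler_sums0 : euler_sums (fun _ : V => 0) 0.
Proof.
exists 0%N, (fun=> 0), (fun=> set0); split=> [[]//|x|]; by rewrite big_ord0.
Qed.

Lemma euler_sumsD psi psi' s s' : euler_sums psi s -> euler_sums psi' s' ->
  euler_sums (fun x => psi x + psi' x) (s + s').
Proof.
move=> [n [m [K [gK psiE ->]]]] [n' [m' [K' [gK' psi'E ->]]]].
pose pick T (f : 'I_n -> T) (f' : 'I_n' -> T) i :=
  match fintype.split i with inl j => f j | inr j => f' j end.
have pickl T f f' j : pick T f f' (lshift n' j) = f j.
  by rewrite /pick (fintype.unsplitK (inl j)).
have pickr T f f' j : pick T f f' (rshift n j) = f' j.
  by rewrite /pick (fintype.unsplitK (inr j)).
exists (n + n')%N, (pick _ m m'), (pick _ K K'); split=> [i|x|].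
- by rewrite /pick; case: (fintype.split i).
- rewrite big_split_ord /= psiE psi'E; congr +%R; apply: eq_bigr => i _.
    by rewrite !pickl.
  by rewrite !pickr.
- rewrite big_split_ord /=; congr +%R; apply: eq_bigr => i _.
    by rewrite !pickl.
  by rewrite !pickr.
Qed.

Lemma euler_sumsZ psi (c s : int) : euler_sums psi s ->
  euler_sums (fun x => c * psi x) (c * s).
Proof.
move=> [n [m [K [gK psiE ->]]]]; exists n, (fun i => c * m i), K.
split=> // [x|].
  by rewrite psiE mulr_sumr; apply: eq_bigr => i _; rewrite mulrA.
by rewrite mulr_sumr.
Qed.

(** A nonempty compact polyhedron is by itself an admissible piece of weight 1. The empty set is not
    contractible, so it is represented by the empty sum. *)
Lemma euler_sums_polyhedron L : compact (polyhedron L : set (fdtop V)) ->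
  euler_sums \1_(polyhedron L) (`[< polyhedron L !=set0 >] : nat)%:Z.
Proof.
move=> cL; case: asboolP => [L0|/nonemptyPn L0]; last first.
  by rewrite L0 (_ : \1_set0 = fun=> 0) ?indic0//; exact: euler_sums0.
exists 1%N, (fun=> 1), (fun=> polyhedron L); split=> [i|x|].
- split=> //; first exact: polyhedron_contractible.
  exact: polyhedron_subanalytic.
- by rewrite big_ord1 mul1r.
- by rewrite big_ord1.
Qed.

(** Testing the zero function suffices: two decompositions of one function differ by a decomposition
    of 0. *)
Definition euler_well_defined :=
  forall s, euler_sums (fun _ : V => 0) s -> s = 0.

Lemma euler_integral_unique psi s : euler_well_defined ->
  euler_sums psi s -> euler_integral psi = s.
Proof.
move=> wd psis; rewrite /euler_integral; suff E : euler_sums psi = [set s].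
  case: xgetP => [t _ /= /esym|/(_ s)]; rewrite E; last by move=> /(_ erefl).
  by move=> /(congr1 (fun A => A s)) /=; rewrite propeqE => -[_] /(_ erefl) ->.
apply/seteqP; split => [t psit|_ ->//] /=.
apply/eqP; rewrite -subr_eq0; apply/eqP/wd.
have := euler_sumsD psit (euler_sumsZ (-1) psis); rewrite mulN1r.
by congr euler_sums; apply/funext => x; rewrite mulN1r subrr.
Qed.

(** Adding a decomposition of 0 of nonzero weight shifts the total weight, so [euler_sums psi] is
    never a singleton and [xget] returns its default 0. *)
Lemma euler_integral_degenerate psi : ~ euler_well_defined ->
  euler_integral psi = 0.
Proof.
move=> /existsNP[s] /not_implyP[s0 sN0]; rewrite /euler_integral.
case: xgetP => [t _ /= E|//]; exfalso; apply: sN0.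
have psit : euler_sums psi t by rewrite E.
have : euler_sums psi (t + s).
  have := euler_sumsD psit s0.
  by congr euler_sums; apply/funext => x; rewrite addr0.
by rewrite E /= => /eqP; rewrite -subr_eq0 addrC addKr => /eqP.
Qed.

Lemma polyhedron_sub_compact L B : compact (polyhedron B : set (fdtop V)) ->
  polyhedron L `<=` polyhedron B -> compact (polyhedron L : set (fdtop V)).
Proof.
move=> cB.
exact: (@subclosed_compact (fdtop V) (polyhedron L) (polyhedron B)
  (@polyhedron_closed _ _ L) cB).
Qed.

(** On the fibre, [phi] is unchanged by truncation to [B]. The truncated pieces are compact
    polyhedra, each of Euler integral 1 or 0 according to whether it meets the fibre. *)
Lemma pushforward_poly_comb (P : seq (int * seq (V' * R))) (phi : V -> int) B
    (xi : V') (t : R) :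
  euler_well_defined ->
  (forall x, phi x = \sum_(k <- P) k.1 * \1_(polyhedron k.2) x) ->
  compact (polyhedron B : set (fdtop V)) ->
  (forall x : V, phi x != 0 -> xi x = t :> R -> polyhedron B x) ->
  Defs.pushforward xi phi t =
    \sum_(k <- P) k.1 * \1_((xi : V -> R) @` polyhedron (k.2 ++ B)) t.
Proof.
move=> wd phiE cB phiB; apply: euler_integral_unique => //.
(* The hyperplane [xi = t] as two opposite closed half-spaces. *)
pose fibre := [:: (xi, t); (- xi, - t)].
have fibreE (x : V) : polyhedron fibre x <-> xi x = t :> R.
  rewrite /polyhedron /= andbT opp_lfunE lerN2; split.
    by move/le_anti/esym.
  by move=> ->; rewrite lexx.
have -> : (fun x => \1_[set y | xi y = t] x * phi x) =
    (fun x => \sum_(k <- P) k.1 * \1_(polyhedron (k.2 ++ B ++ fibre)) x).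
  apply/funext => x.
  have [xit|xit] := eqVneq (xi x : R) t; last first.
    rewrite indicE memNset /=; last by apply/eqP.
    rewrite mul0r big1// => k _; rewrite indicE memNset ?mulr0//.
    by rewrite !polyhedron_cat => -[_ [_ /fibreE/eqP]]; exact/negP.
  rewrite indicE mem_set// mul1r; have [xB|xB] := pselect (polyhedron B x).
    rewrite phiE; apply: eq_bigr => k _; congr *%R; rewrite !indicE.
    congr (nat_of_bool _)%:R.
    apply/idP/idP; rewrite !inE !polyhedron_cat; last by case.
    by move=> xk; split => //; split => //; apply/fibreE.
  have -> : phi x = 0 by apply: contra_notP xB => /eqP /phiB; exact.
  rewrite big1// => k _; rewrite indicE memNset ?mulr0//.
  by rewrite !polyhedron_cat => -[_ []].
(* The formula for [phi] is dropped before the induction, since it holds only for the whole list. *)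
elim: P {phiE} => [|k P IHP].
  rewrite big_nil; have := euler_sums0; congr euler_sums.
  by apply/funext => x; rewrite big_nil.
rewrite big_cons; under eq_fun do rewrite big_cons.
apply: euler_sumsD => //.
have : compact (polyhedron (k.2 ++ B ++ fibre) : set (fdtop V)).
  by apply: polyhedron_sub_compact cB _; rewrite !polyhedron_cat => x [_ []].
move=> /euler_sums_polyhedron /(euler_sumsZ k.1); congr (euler_sums _ (_ * _)).
(* The piece meets the fibre exactly when [t] lies in the image of the piece cut by [B]. *)
rewrite indicE -natz; congr (nat_of_bool _)%:R.
apply/asboolP/idP; rewrite inE.
  by move=> [x]; rewrite !polyhedron_cat => -[? [? /fibreE]]; exists x.
move=> [x]; rewrite polyhedron_cat => -[kx Bx] xit.
exists x; rewrite !polyhedron_cat.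
by split => //; split => //; exact/fibreE.
Qed.

End EulerSums.

(** * PL-constructible functions as combinations of closed polyhedra *)

Section PolyComb.
Context {R : realType} (V : vectType R).
Local Notation V' := 'Hom(V, R^o).
Implicit Types (f g : V -> int) (L : seq (V' * R)).

(** The polyhedra may overlap and be unbounded. Such functions form a ring, products of indicators
    being indicators of concatenated lists. *)
Definition poly_comb f (P : seq (int * seq (V' * R))) : Prop :=
  forall x, f x = \sum_(k <- P) k.1 * \1_(polyhedron k.2) x.

Lemma poly_comb_cst (c : int) : poly_comb (fun=> c) [:: (c, [::])].
Proof. by move=> x; rewrite big_seq1 indicE mem_set// mulr1. Qed.

Lemma poly_combD f g P Q : poly_comb f P -> poly_comb g Q ->
  poly_comb (fun x => f x + g x) (P ++ Q).
Proof. by move=> fP gQ x; rewrite big_cat fP gQ. Qed.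

Lemma poly_combM f g P Q : poly_comb f P -> poly_comb g Q ->
  poly_comb (fun x => f x * g x)
    [seq (k.1 * l.1, k.2 ++ l.2) | k <- P, l <- Q].
Proof.
move=> fP gQ x; rewrite big_allpairs_dep fP gQ mulr_suml.
apply: eq_bigr => k _; rewrite mulr_sumr; apply: eq_bigr => l _ /=.
rewrite polyhedron_cat mulrACA; congr *%R.
by rewrite !indicE in_setI -mulnb natrM.
Qed.

Lemma poly_comb_sum (I : Type) (s : seq I) (F : I -> V -> int) :
  (forall i, exists P, poly_comb (F i) P) ->
  exists P, poly_comb (fun x => \sum_(i <- s) F i x) P.
Proof.
move=> FP; elim: s => [|i s [Q sQ]].
  by exists [::] => x; rewrite !big_nil.
have [P iP] := FP i; exists (P ++ Q) => x.
by rewrite big_cons; exact: (poly_combD iP sQ).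
Qed.

Lemma poly_comb_prod (I : Type) (s : seq I) (F : I -> V -> int) :
  (forall i, exists P, poly_comb (F i) P) ->
  exists P, poly_comb (fun x => \prod_(i <- s) F i x) P.
Proof.
move=> FP; elim: s => [|i s [Q sQ]].
  by exists [:: (1, [::])] => x; rewrite big_nil; exact: poly_comb_cst.
have [P iP] := FP i; exists [seq (k.1 * l.1, k.2 ++ l.2) | k <- P, l <- Q] => x.
by rewrite big_cons; exact: (poly_combM iP sQ).
Qed.

Lemma poly_comb_halfspace (xi : V') (c : R) (b : bool) :
  exists P, poly_comb \1_[set x : V | c < (xi x : R) ?<= if b] P.
Proof.
case: b.
  exists [:: (1, [:: (xi, c)])] => x; rewrite big_seq1 mul1r.
  by congr (\1_ _ _); apply/seteqP; split => y; rewrite /polyhedron/= andbT.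
exists ([:: (1, [::])] ++ [:: (-1, [:: (- xi, - c)])]) => x.
rewrite big_cat !big_seq1 /= mul1r mulN1r.
have oppE : polyhedron [:: (- xi, - c)] x <-> (xi x : R) <= c.
  by rewrite /polyhedron /= andbT opp_lfunE lerN2.
rewrite !indicE [x \in polyhedron [::]]mem_set//.
have [xc|xc] := leP (xi x : R) c.
  rewrite memNset /=; last by apply/negP; rewrite -leNgt.
  by rewrite mem_set ?subrr//; exact/oppE.
rewrite mem_set// memNset ?subr0// => /oppE.
by rewrite leNgt xc.
Qed.

(** The indicator of an intersection is the product of the indicators of the half-spaces. *)
Lemma poly_comb_polyhedron (S : set V) : convex_polyhedron S ->
  exists P, poly_comb \1_S P.
Proof.
move=> [n [xi [c [b [_ ->]]]]].
have [P PE] := poly_comb_prod (index_enum 'I_n)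
  (fun i => poly_comb_halfspace (xi i) (c i) (b i)).
exists P => x; rewrite -PE; have [xS|xS] := pselect
    (forall i, c i < (xi i x : R) ?<= if b i).
  rewrite indicE mem_set// big1// => i _.
  by rewrite indicE mem_set//; exact: xS.
rewrite indicE memNset//; move/existsNP : xS => [i xi_i].
by rewrite (bigD1 i)//= indicE memNset ?mul0r.
Qed.

Lemma PL_constructible_poly_comb (phi : V -> int) : PL_constructible phi ->
  exists P, poly_comb phi P.
Proof.
move=> [n [S [Spoly [Scover Striv Sne] phiS]]].
(* Cells of a partition are nonempty, so each has a representative at which the constant value of
   [phi] is read. *)
have /choice[p pS] : forall a, exists x, S a x by move=> a; exact: Sne.
have SE (a : 'I_n) : exists P, poly_comb (fun x => phi (p a) * \1_(S a) x) P.
  have [P PE] := poly_comb_polyhedron (Spoly a); eexists => x.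
  exact: (poly_combM (poly_comb_cst (phi (p a))) PE x).
have [P PE] := poly_comb_sum (index_enum 'I_n) SE.
exists P => x; rewrite -PE.
have [a _ Sax] : cover setT S x by rewrite Scover.
rewrite (bigD1 a)//= indicE mem_set// mulr1 big1 ?addr0 => [|b ba].
  exact: (phiS a).
rewrite indicE memNset ?mulr0// => Sbx; move/eqP: ba; apply.
by apply: Striv => //; exists x.
Qed.

End PolyComb.

Lemma subset1_finite T (A : set T) : is_subset1 A -> finite_set A.
Proof.
move=> A1; have [[x Ax]|/nonemptyPn->//] := pselect (A !=set0).
by apply: (@sub_finite_set _ _ [set x]) => // y Ay; exact: A1.
Qed.

(** * Dependence of images of polyhedra on the covector *)

Section Slices.
Import VectorInternalTheory.
Context {R : realType} (V : vectType R).
Local Notation V' := 'Hom(V, R^o).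

Lemma hom_uniform (Q : set V) (xi0 : V') (e : R) :
  compact (Q : set (fdtop V)) -> 0 < e ->
  exists2 d : R, 0 < d & forall xi : V', `|v2r xi - v2r xi0| < d ->
    forall x, Q x -> `|(xi x : R) - xi0 x| < e.
Proof.
move=> /fdtop_compact_bounded[r Qr] e0; have [c c0 cP] := hom_norm_bound V.
have k0 : 0 < c * (`|r| + 1) by rewrite mulr_gt0// ltr_wpDl.
(* The bound [r] has no known sign; [|r| + 1] keeps the denominator positive. *)
exists (e / (c * (`|r| + 1))); first by rewrite divr_gt0.
move=> xi; rewrite ltr_pdivlMr// => xid x Qx.
have -> : (xi x : R) - xi0 x = (xi - xi0) x by rewrite add_lfunE opp_lfunE.
rewrite (le_lt_trans (cP _ _))// (le_lt_trans _ xid)//.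
rewrite linearB/= mulrCA -mulrA; apply: ler_wpM2l; first exact: ltW.
apply: ler_wpM2l => //; rewrite (le_trans (Qr _ Qx))//.
by rewrite (le_trans (ler_norm _))// lerDl.
Qed.

(** The attained maximum and minimum of [xi] on [Q], hence at most two values. *)
Definition extremal_values (Q : set V) (xi : V') : set R :=
  [set t | ((xi : V -> R) @` Q) t /\
    ((forall x, Q x -> (xi x : R) <= t) \/ (forall x, Q x -> t <= (xi x : R)))].

Lemma extremal_values_countable Q xi : countable (extremal_values Q xi).
Proof.
pose M := [set t | ((xi : V -> R) @` Q) t /\ forall x, Q x -> (xi x : R) <= t].
pose m := [set t | ((xi : V -> R) @` Q) t /\ forall x, Q x -> t <= (xi x : R)].
apply: (@sub_countable _ _ _ (M `|` m)).
  by apply: subset_card_le => t [Qt [tM|tm]]; [left|right].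
apply: finite_set_countable; rewrite finite_setU; split.
  apply: subset1_finite => _ _ [[x Qx <-] xM] [[y Qy <-] yM].
  by apply/le_anti; rewrite xM// yM.
apply: subset1_finite => _ _ [[x Qx <-] xm] [[y Qy <-] ym].
by apply/le_anti; rewrite xm// ym.
Qed.

(** If [t] is in the image but not extremal, points with values strictly on either side of [t] keep
    these sides for nearby [xi], and the segment joining them meets level [t]. If [t] is outside,
    the image is compact, so [t] is at positive distance from it, and values move uniformly
    little. *)
Lemma polyhedron_image_locally_constant L (xi0 : V') (t : R) :
  compact (polyhedron L : set (fdtop V)) ->
  ~ extremal_values (polyhedron L) xi0 t ->
  exists2 d : R, 0 < d & forall xi : V', `|v2r xi - v2r xi0| < d ->
    ((xi : V -> R) @` polyhedron L) t <-> ((xi0 : V -> R) @` polyhedron L) t.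
Proof.
move=> cL text; have [tL|tL] := pselect (((xi0 : V -> R) @` polyhedron L) t).
  have [x Lx tx] : exists2 x, polyhedron L x & t < (xi0 x : R).
    apply: contrapT => /forall2NP tx; apply: text; split => //; left => x Lx.
    by have [//|/negP] := tx x; rewrite -leNgt.
  have [y Ly yt] : exists2 y, polyhedron L y & (xi0 y : R) < t.
    apply: contrapT => /forall2NP yt; apply: text; split => //; right => y Ly.
    by have [//|/negP] := yt y; rewrite -leNgt.
  have e0 : 0 < Num.min ((xi0 x : R) - t) (t - (xi0 y : R)).
    by rewrite lt_min !subr_gt0 tx.
  have [d d0 dP] := hom_uniform xi0 cL e0; exists d => // xi xid.
  split=> // _.
  have := dP _ xid _ Lx; have := dP _ xid _ Ly.
  rewrite !lt_min !ltr_norml => /andP[_ /andP[_ yd]] /andP[/andP[xd _] _].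
  have ty : (xi y : R) < t by lra.
  have xt : t < (xi x : R) by lra.
  have xy0 : 0 < (xi x : R) - xi y by lra.
  (* The parameter at which the affine function [xi] equals [t] on the segment from [y] to [x]. *)
  have [s s01 sE] : exists2 s, s \in `[0, 1] &
      (1 - s) * (xi y : R) + s * (xi x : R) = t.
    exists ((t - (xi y : R)) / ((xi x : R) - xi y)).
      rewrite in_itv/=; apply/andP; split; first by apply: divr_ge0; lra.
      by rewrite ler_pdivrMr// mul1r lerD2r ltW.
    by field; rewrite gt_eqF.
  exists ((1 - s) *: y + s *: x); first exact: polyhedron_convex.
  by rewrite linearD !linearZ.
have : open (~` ((xi0 : V -> R) @` polyhedron L)).
  apply: closed_openC; apply: compact_closed; first exact: Rhausdorff.
  apply: (@continuous_compact (fdtop V) R xi0 (polyhedron L)) => //.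
  exact: (continuous_subspaceT (hom_continuous (xi := xi0))).
rewrite openE => /(_ _ tL) /nbhs_ballP[e /= e0 eP].
have [d d0 dP] := hom_uniform xi0 cL e0; exists d => // xi xid.
split => // -[x Lx xt]; exfalso; apply: (eP (xi0 x : R)); last by exists x.
by rewrite -ball_normE /= -xt; exact: dP.
Qed.

End Slices.

(** * Dominated convergence for integrals against slices *)

Section SliceIntegral.
Import VectorInternalTheory.
Context {R : realType} (V : vectType R).
Local Notation V' := 'Hom(V, R^o).
Local Notation mu := (@lebesgue_measure R).
(** In the application [p] is the pushforward of [phi], [B n] is a box containing the relevant
    points of the fibres over |t| <= n, and [I] contains the values taken on the support. The list
    [P] is common to all [n]. *)
Context (P : seq (int * seq (V' * R))) (B : nat -> seq (V' * R)).
Context (p : V' -> R -> int) (xi0 : V') (d0 : R) (I : set R).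
Hypothesis d0_gt0 : 0 < d0.
Hypothesis B_compact : forall n, compact (polyhedron (B n) : set (fdtop V)).
Hypothesis pE : forall n xi t, `|v2r xi - v2r xi0| < d0 -> `|t| <= n%:R ->
  p xi t = \sum_(k <- P) k.1 * \1_((xi : V -> R) @` polyhedron (k.2 ++ B n)) t.
Hypothesis p_supp : forall xi t, `|v2r xi - v2r xi0| < d0 -> ~ I t ->
  p xi t = 0.

Let near0 : `|v2r xi0 - v2r xi0| < d0.
Proof. by rewrite subrr normr0. Qed.

Let PB_compact k n : compact (polyhedron (k ++ B n) : set (fdtop V)).
Proof.
apply: (polyhedron_sub_compact (@B_compact n)); rewrite polyhedron_cat.
by move=> x [].
Qed.

Lemma slice_measurable (xi : V') : `|v2r xi - v2r xi0| < d0 ->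
  measurable_fun setT (fun t => (p xi t)%:~R : R).
Proof.
(* The formula in terms of [B n] is available only for |t| <= n; on each such interval it combines
   indicators of compact sets. *)
move=> xid; have -> : [set: R] = \bigcup_n `[- n%:R, (n%:R : R)]%classic.
  apply/esym/seteqP; split => // t _; exists (Num.bound `|t|) => //=.
  by rewrite in_itv/= -ler_norml ltW// archi_boundP.
apply/measurable_fun_bigcup => // n.
apply: (eq_measurable_fun (fun t => \sum_(k <- P) k.1%:~R *
    (\1_((xi : V -> R) @` polyhedron (k.2 ++ B n)) t : R))).
  move=> t; rewrite inE/= in_itv/= -ler_norml => tn.
  rewrite (pE xid tn) rmorph_sum; apply: eq_bigr => k _ /=.
  by rewrite rmorphM !indicE rmorph_nat.
apply: measurable_sum => k; apply: measurable_funM; first exact: measurable_cst.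
apply: measurable_funTS; apply: measurable_indic.
apply: compact_measurable.
apply: (@continuous_compact (fdtop V) R xi (polyhedron (k.2 ++ B n))) => //.
exact: (continuous_subspaceT (hom_continuous (xi := xi))).
Qed.

Let M : R := \sum_(k <- P) `|k.1|%:~R.

(** The box depends on [t], but the weights do not, so their total absolute value bounds every
    slice. *)
Lemma slice_bounded xi t : `|v2r xi - v2r xi0| < d0 ->
  `|(p xi t)%:~R : R| <= M.
Proof.
move=> xid; rewrite (pE xid (ltW (archi_boundP (normr_ge0 t)))).
rewrite rmorph_sum (le_trans (ler_norm_sum _ _ _))// /M.
apply: ler_sum => k _; rewrite rmorphM normrM intr_norm /= indicE.
by rewrite ler_piMr//; case: (_ \in _); rewrite ?normr1 ?normr0.
Qed.

Lemma slice_locally_constant : exists2 E : set R, countable E &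
  forall t, ~ E t -> exists2 d, 0 < d & forall xi : V',
    `|v2r xi - v2r xi0| < d -> p xi t = p xi0 t.
Proof.
(* The union runs over all boxes because the box used at [t] depends on |t|, whereas the exceptional
   set is fixed first. *)
exists (\bigcup_n \bigcup_(i in `I_(size P))
    extremal_values (polyhedron ((nth (0, [::]) P i).2 ++ B n)) xi0).
  apply: bigcup_countable => // n _; apply: bigcup_countable => // i _.
  exact: extremal_values_countable.
move=> t tE; pose n := Num.bound `|t|.
have tn : `|t| <= n%:R := ltW (archi_boundP (normr_ge0 t)).
suff [d d_gt0 dP] : exists2 d, 0 < d & forall xi : V',
    `|v2r xi - v2r xi0| < d ->
    \sum_(k <- P) k.1 * \1_((xi : V -> R) @` polyhedron (k.2 ++ B n)) t =
    \sum_(k <- P) k.1 * \1_((xi0 : V -> R) @` polyhedron (k.2 ++ B n)) t.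
  exists (Num.min d d0) => [|xi]; first by rewrite lt_min d_gt0.
  rewrite lt_min => /andP[xid xid0].
  by rewrite (pE xid0 tn) (pE near0 tn); exact: dP.
have : forall k, k \in P -> ~ extremal_values (polyhedron (k.2 ++ B n)) xi0 t.
  move=> k kP kt; apply: tE; exists n => //; exists (index k P) => /=.
    by rewrite index_mem.
  by rewrite nth_index.
(* Induction on the pieces, taking the minimum of their radii. *)
elim: P => [_|k s IHs sE]; first by exists 1 => // xi _; rewrite !big_nil.
have [|d1 d1_gt0 d1P] := IHs.
  by move=> l ls; apply: sE; rewrite inE ls orbT.
have [|d2 d2_gt0 d2P] :=
    polyhedron_image_locally_constant (xi0 := xi0) (t := t) (@PB_compact k.2 n).
  by apply: sE; rewrite mem_head.
exists (Num.min d1 d2) => [|xi]; first by rewrite lt_min d1_gt0.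
rewrite lt_min => /andP[xid1 xid2]; rewrite !big_cons d1P//; congr (_ * _ + _).
by rewrite !indicE; congr (nat_of_bool _)%:R; apply/idP/idP;
  rewrite !inE => /(d2P _ xid2).
Qed.

Section Kernel.
(** A real kernel, later the real or the imaginary part of the complex one. *)
Context (kappa : R -> R).
Hypothesis kappa_meas : measurable_fun setT kappa.
Hypothesis I_meas : measurable I.
Hypothesis kappa_int : mu.-integrable I (EFin \o kappa).

Let F xi t : \bar R := (kappa t * (p xi t)%:~R)%:E.
(** A single dominating function for all [xi] within [d0] of [xi0]; it may vanish off [I] because
    the slices do. *)
Let G : R -> \bar R := (fun t => M%:E * `|kappa t|%:E)%E \_ I.

Let F_meas xi : `|v2r xi - v2r xi0| < d0 -> measurable_fun setT (F xi).
Proof.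
move=> xid; apply/measurable_EFinP; apply: measurable_funM => //.
exact: slice_measurable.
Qed.

Let FG xi t : `|v2r xi - v2r xi0| < d0 -> (`|F xi t| <= G t)%E.
Proof.
move=> xid; rewrite /F /G /patch; case: ifPn => [_|].
  rewrite -EFinM lee_fin normrM mulrC ler_wpM2r//.
  exact: slice_bounded.
by rewrite notin_setE => /(p_supp xid) ->; rewrite mulr0z mulr0 abse0.
Qed.

Let G_int : mu.-integrable setT G.
Proof.
have : mu.-integrable I (fun t => (M%:E * `|kappa t|%:E)%E).
  by apply: (@integrableZl _ _ _ mu I I_meas M _); exact: integrable_norm.
by move=> /(@integrable_mkcond _ _ _ mu I _ I_meas).1.
Qed.

Lemma slice_integrable : mu.-integrable setT (F xi0).
Proof.
apply: le_integrable G_int => //; first exact: F_meas.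
move=> t _; rewrite (le_trans (FG t near0))//; exact: lee_abs.
Qed.

Lemma slice_integral_continuous (e : R) : 0 < e ->
  exists2 d, 0 < d & forall xi : V', `|v2r xi - v2r xi0| < d ->
    `|\int[mu]_t (kappa t * (p xi t)%:~R) -
      \int[mu]_t (kappa t * (p xi0 t)%:~R)| < e.
Proof.
(* Dominated convergence concerns sequences, so a failure of continuity is turned into covectors
   [xi_ n] tending to [xi0] whose integrals stay at distance at least [e]. *)
move=> e_gt0; apply: contrapT => /forall2NP noK.
have bad (n : nat) : exists xi : V',
    (`|v2r xi - v2r xi0| < d0 /\ `|v2r xi - v2r xi0| < n.+1%:R^-1) /\
    e <= `|\int[mu]_t (kappa t * (p xi t)%:~R) -
      \int[mu]_t (kappa t * (p xi0 t)%:~R)|.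
  have [/negP|/existsNP[xi /not_implyP[xid /negP]]] :=
    noK (Num.min d0 n.+1%:R^-1).
    by rewrite lt_min d0_gt0 invr_gt0 ltr0n.
  rewrite -leNgt; exists xi; split => //.
  by apply/andP; rewrite -lt_min.
have [xi_ xi_P] := choice bad.
have [E cE EP] := slice_locally_constant.
have xi_cvg t : ~ E t -> F (xi_ n) t @[n --> \oo] --> F xi0 t.
  move=> /EP[d d_gt0 dP]; apply: cvg_near_cst.
  have := near_infty_natSinv_lt (PosNum d_gt0); apply: filterS => n nd.
  by rewrite /F dP// (lt_trans (xi_P n).1.2).
(* Off the countable, hence null, set [E] the sequence is eventually constant. *)
have ae_cvg : {ae mu, forall t, setT t -> F (xi_ n) t @[n --> \oo] --> F xi0 t}.
  exists E; split; [by apply: countable_measurable cE => t;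
    exact: measurable_set1|exact: countable_lebesgue_measure0|].
  by move=> t /not_implyP[_ tE]; apply: contrapT => /xi_cvg.
have ae_bound : {ae mu, forall t n, setT t -> (`|F (xi_ n) t| <= G t)%E}.
  by apply: aeW => t n _; apply: FG; exact: (xi_P n).1.1.
have [_ _] := @dominated_convergence _ _ _ mu setT measurableT
  (fun n => F (xi_ n)) (F xi0) G (fun n => F_meas (xi_P n).1.1) (F_meas near0)
  ae_cvg G_int ae_bound.
rewrite -[X in _ --> X]fineK; last first.
  by apply: integrable_fin_num => //; exact: slice_integrable.
move=> /fine_cvgP[_ /cvgrPdist_lt /(_ _ e_gt0)[N _ /(_ N (leqnn _))]] /=.
by rewrite distrC ltNge (xi_P N).2.
Qed.

End Kernel.
End SliceIntegral.

(** * Sup-norm boxes and coercivity on the interior of the polar *)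

Section Boxes.
Import VectorInternalTheory.
Context {R : realType} (V : vectType R).
Local Notation V' := 'Hom(V, R^o).

Let coord (i : 'I_(dim V)) (x : V) : R^o := v2r x 0 i.

Let coord_is_linear i : linear (coord i).
Proof. by move=> a x y; rewrite /coord linearP !mxE. Qed.

HB.instance Definition _ i := GRing.isLinear.Build R V R^o *:%R (coord i)
  (coord_is_linear i).

Definition coord_form i : V' := linfun (coord i).

Lemma coord_formE i x : (coord_form i x : R) = v2r x 0 i.
Proof. by rewrite lfunE. Qed.

Definition box (r : R) : seq (V' * R) :=
  [seq (coord_form i, - r) | i <- enum 'I_(dim V)] ++
  [seq (- coord_form i, - r) | i <- enum 'I_(dim V)].

Lemma mem_box r x : 0 <= r -> polyhedron (box r) x <-> `|v2r x| <= r.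
Proof.
move=> r0; split.
  move=> /allP xr; rewrite [leLHS]/Num.Def.normr/= mx_normrE.
  apply/bigmax_leP; split => // -[i j] _ /=; rewrite (ord1 i).
  have jV : j \in enum 'I_(dim V) by rewrite mem_enum.
  have := xr (coord_form j, - r); have := xr (- coord_form j, - r).
  rewrite !mem_cat !(map_f (fun i => (coord_form i, - r)) jV).
  rewrite !(map_f (fun i => (- coord_form i, - r)) jV) orbT.
  by rewrite /= opp_lfunE lerN2 coord_formE ler_norml => -> // ->.
move=> xr; have entry i : - r <= v2r x 0 i <= r.
  by rewrite -ler_norml; apply: le_trans xr; exact: entry_le_norm.
apply/allP => h; rewrite mem_cat => /orP[] /mapP[i _ ->] /=.
  by rewrite coord_formE; case/andP: (entry i).
by rewrite opp_lfunE lerN2 coord_formE; case/andP: (entry i).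
Qed.

Lemma box_compact r : 0 <= r -> compact (polyhedron (box r) : set (fdtop V)).
Proof.
move=> r0; apply: (fdtop_bounded_compact (r := r)) => [|x /mem_box]; last exact.
exact: polyhedron_closed.
Qed.

(** Near [xi0], subtracting from [xi] a small multiple of a coordinate form stays in the polar.
    Choosing a largest coordinate of [x], with its sign, and evaluating at [x] gives the lower
    bound. *)
Lemma interior_polar_coercive (C : set V) (xi0 : V') :
  interior (polar C : set (fdtop V')) xi0 ->
  exists d e : R, [/\ 0 < d, 0 < e & forall xi : V', `|v2r xi - v2r xi0| < d ->
    forall x, C x -> e * `|v2r x| <= (xi x : R)].
Proof.
move=> /fdtop_nbhsP[d d0 dC].
(* A positive bound for the norms of all coordinate forms; a multiple of size [d / 2 / K] then moves
   [xi] by at most [d / 2]. *)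
pose K : R := 1 + \sum_i `|v2r (coord_form i)|.
have K0 : 0 < K by rewrite ltr_pwDl// sumr_ge0.
have Ki i : `|v2r (coord_form i)| <= K.
  by rewrite /K (bigD1 i)//= addrCA lerDl addr_ge0// sumr_ge0.
exists (d / 2), (d / 2 / K); split; [exact: divr_gt0|by rewrite !divr_gt0|].
move=> xi xid x Cx; have [x0|xN0] := eqVneq (v2r x) 0.
  by rewrite x0 normr0 mulr0; apply: (dC xi) => //; lra.
have /mx_norm_neq0[[i j]] : mx_norm (v2r x) != 0.
  by apply: contra_neq xN0; exact: mx_norm_eq0.
rewrite /= (ord1 i) => xj; rewrite [`|v2r x|]xj.
(* With this sign, [s] times the [j]-th coordinate is [d / 2 / K] times the norm of [x]. *)
pose s : R := d / 2 / K * Num.sg (v2r x 0 j).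
have : polar C (xi - s *: coord_form j).
  apply: dC; rewrite linearB linearZ /= addrAC.
  apply: le_lt_trans (ler_normB _ _) _; rewrite normrZ.
  have : `|s| * `|v2r (coord_form j)| <= d / 2.
    have -> : d / 2 = d / 2 / K * K by rewrite divfK// gt_eqF.
    apply: ler_pM => //; rewrite /s normrM ger0_norm; last first.
      by rewrite !divr_ge0// ltW.
    apply: ler_piMr; first by rewrite !divr_ge0// ltW.
    by rewrite normr_sg; case: (_ != _); rewrite ?lexx ?ler01.
  lra.
move=> /(_ _ Cx); rewrite add_lfunE opp_lfunE scale_lfunE subr_ge0.
by rewrite coord_formE /GRing.scale /= /s normrEsg mulrA.
Qed.

Lemma interior_polar_antipodal_coercive (C : set V) (xi0 : V') :
  interior (polar (antipodal C) : set (fdtop V')) xi0 ->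
  exists d e : R, [/\ 0 < d, 0 < e & forall xi : V', `|v2r xi - v2r xi0| < d ->
    forall x, C x -> e * `|v2r x| <= - (xi x : R)].
Proof.
move=> /interior_polar_coercive[d [e [d0 e0 coercive]]].
exists d, e; split => // xi xid x Cx.
have := coercive _ xid (- x); rewrite !linearN normrN; apply.
by exists x.
Qed.

End Boxes.

(** The sets may overlap: the restriction to the union is dominated by the sum of the absolute
    values of the two restrictions. *)
Lemma integrable_setU d (T : measurableType d) (R : realType)
    (mu : {measure set T -> \bar R}) (A B : set T) (f : T -> \bar R) :
  measurable A -> measurable B ->
  mu.-integrable A f -> mu.-integrable B f -> mu.-integrable (A `|` B) f.
Proof.
move=> mA mB fA fB; have mAB := measurableU _ _ mA mB.
apply/(integrable_mkcond f mAB).2.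
have fA' := (integrable_mkcond f mA).1 fA.
have fB' := (integrable_mkcond f mB).1 fB.
apply: (@le_integrable _ _ _ mu setT measurableT _
  (fun t => `|(f \_ A) t| + `|(f \_ B) t|)%E); last first.
- exact: integrableD (integrable_abse fA') (integrable_abse fB').
- move=> t _; rewrite [leRHS]gee0_abs ?adde_ge0// /patch in_setU.
  case: (t \in A); case: (t \in B) => /=;
    by rewrite ?normr0 ?adde0 ?add0e ?leeDl.
- apply/(measurable_restrictT _ mAB).1; apply/(measurable_funU _ mA mB).
  by split; [exact: measurable_int fA|exact: measurable_int fB].
Qed.

(** * Reduction of complex integrals to real and imaginary parts *)

Section ComplexValued.
Context {R : realType}.
Local Notation mu := (@lebesgue_measure R).

Lemma Re_mul_int (z : R[i]) (m : int) :
  complex.Re (z * m%:~R) = complex.Re z * m%:~R.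
Proof.
rewrite -(rmorph_int (real_complex R)).
by case: z => a b /=; rewrite mulr0 subr0.
Qed.

Lemma Im_mul_int (z : R[i]) (m : int) :
  complex.Im (z * m%:~R) = complex.Im z * m%:~R.
Proof.
rewrite -(rmorph_int (real_complex R)).
by case: z => a b /=; rewrite mulr0 add0r.
Qed.

Lemma complex_norm_lt (z : R[i]) (e : R) :
  `|complex.Re z| < e / 2 -> `|complex.Im z| < e / 2 -> `|z| < (e%:C)%C.
Proof.
move=> ze1 ze2; have e0 : 0 < e.
  by have := le_lt_trans (normr_ge0 _) ze1; lra.
rewrite normc_def ltcR -[ltRHS]ger0_norm ?ltW// -sqrtr_sqr.
rewrite ltr_sqrt ?exprn_gt0//.
have sq (a : R) : `|a| < e / 2 -> `|a| ^+ 2 < (e / 2) ^+ 2.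
  by move=> ae; rewrite ltr_pXn2r// nnegrE; lra.
have := sq _ ze1; have := sq _ ze2.
rewrite !real_normK ?num_real//.
have : 0 < e ^+ 2 by rewrite exprn_gt0.
by rewrite expr_div_n; lra.
Qed.

Lemma clocally_integrable_compact (f : R -> R[i]) (K : set R) :
  clocally_integrable f -> compact K -> cintegrable K f.
Proof.
move=> [[mr _ fr] [mi _ fi]] cK; split; apply/integrableP; split.
- by apply/measurable_EFinP; exact: measurable_funTS.
- exact: fr.
- by apply/measurable_EFinP; exact: measurable_funTS.
- exact: fi.
Qed.

Lemma cintegrable_setU (f : R -> R[i]) (A B : set R) :
  measurable A -> measurable B ->
  cintegrable A f -> cintegrable B f -> cintegrable (A `|` B) f.
Proof.
by move=> mA mB [fA gA] [fB gB]; split; apply: integrable_setU.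
Qed.

Lemma cintegrableS (f : R -> R[i]) (A B : set R) :
  measurable A -> measurable B -> A `<=` B ->
  cintegrable B f -> cintegrable A f.
Proof.
move=> mA mB AB [fr fi].
by split; [apply: integrableS fr|apply: integrableS fi].
Qed.

End ComplexValued.

(** * Local continuity of the hybrid transform *)

Section HybridTransform.
Import VectorInternalTheory.
Context {R : realType} (V : vectType R).
Local Notation V' := 'Hom(V, R^o).

Lemma pushforward_eq0 (phi : V -> int) (xi : V') (t : R) :
  (forall x : V, phi x != 0 -> xi x <> t :> R) -> Defs.pushforward xi phi t = 0.
Proof.
move=> phi0.
have [wd|degenerate] := pselect (@euler_well_defined R V); last first.
  exact: euler_integral_degenerate.
rewrite /Defs.pushforward (_ : (fun x => _) = fun=> 0).
  by apply: euler_integral_unique => //; exact: euler_sums0.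
apply/funext => x.
have [->|/phi0 xt] := eqVneq (phi x) 0; first by rewrite mulr0.
by rewrite indicE memNset ?mul0r.
Qed.

(** Common core of the compact and conic cases: [I] confines the values of nearby covectors on the
    support, and [r n] bounds the support points where these values are at most [n] in modulus. *)
Lemma hybrid_local (kappa : R -> R[i]) (phi : V -> int) (xi0 : V') (d : R)
    (I : set R) (r : nat -> R) :
  clocally_integrable kappa -> PL_constructible phi -> 0 < d ->
  measurable I -> cintegrable I kappa ->
  (forall xi : V', `|v2r xi - v2r xi0| < d ->
     forall x, supp phi x -> I (xi x)) ->
  (forall n (xi : V'), `|v2r xi - v2r xi0| < d ->
     forall x, supp phi x -> `|xi x : R| <= n%:R -> `|v2r x| <= r n) ->
  hybrid_domain kappa phi xi0 /\
  {for xi0, continuous (hybrid_transform kappa phi : fdtop V' -> R[i]^o)}.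
Proof.
move=> [[mr _ _] [mi _ _]] phiPL d0 mI [kr ki] suppI suppr.
have near0 : `|v2r xi0 - v2r xi0| < d by rewrite subrr normr0.
have phi_supp x : phi x != 0 -> supp phi x.
  by move=> ?; exact: (@subset_closure (fdtop V)).
pose B n := box V (Num.max 0 (r n)).
have cB n : compact (polyhedron (B n) : set (fdtop V)).
  by apply: box_compact; rewrite le_max lexx.
have suppB n (xi : V') x : `|v2r xi - v2r xi0| < d -> supp phi x ->
    `|xi x : R| <= n%:R -> polyhedron (B n) x.
  move=> xid xS xn; apply/mem_box; rewrite le_max ?lexx//.
  by rewrite (suppr n xi) ?orbT.
(* If Euler integration is degenerate, every pushforward is 0 and the empty list serves. *)
have [P pE] : exists P : seq (int * seq (V' * R)), forall n xi t,
    `|v2r xi - v2r xi0| < d -> `|t| <= n%:R -> Defs.pushforward xi phi t =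
    \sum_(k <- P) k.1 * \1_((xi : V -> R) @` polyhedron (k.2 ++ B n)) t.
  have [wd|degenerate] := pselect (@euler_well_defined R V); last first.
    exists [::] => n xi t _ _; rewrite big_nil.
    exact: euler_integral_degenerate.
  have [P phiE] := PL_constructible_poly_comb phiPL.
  exists P => n xi t xid tn.
  apply: pushforward_poly_comb => // x /phi_supp xS xt.
  by apply: (suppB n xi) => //; rewrite xt.
have p_supp xi t : `|v2r xi - v2r xi0| < d -> ~ I t ->
    Defs.pushforward xi phi t = 0.
  move=> xid tI; apply: pushforward_eq0 => x /phi_supp xS xt; apply: tI.
  by rewrite -xt; exact: suppI.
have int_r := slice_integrable d0 cB pE p_supp mr mI kr.
have int_i := slice_integrable d0 cB pE p_supp mi mI ki.
split.
  split.
    (* Properness: a compact set of values lies in some [-N, N], so its preimage in the support is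
       closed and bounded by [r N]. *)
    move=> K cK; have [N KN] : exists N : nat, forall t, K t -> `|t| <= N%:R.
      have /pinfty_ex_gt0[N _ NP] := compact_bounded cK.
      by exists (Num.bound `|N|) => t /NP /le_trans; apply;
        rewrite (le_trans (ler_norm _))// ltW// archi_boundP.
    apply: (fdtop_bounded_compact (r := r N)).
      apply: (@closedI (fdtop V)); first exact: (@closed_closure (fdtop V)).
      by have := @preimage_closed (fdtop V) R xi0 K
        (in1W (hom_continuous (xi := xi0))) (compact_closed (@Rhausdorff R) cK).
    by move=> x [xS /KN xN]; exact: (suppr N xi0).
  split.
    by move: int_r; under eq_fun do rewrite -Re_mul_int.
  by move: int_i; under eq_fun do rewrite -Im_mul_int.
apply/(@cvgrPdist_lt _ _ _ (nbhs (xi0 : fdtop V'))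
  (nbhs_filter (xi0 : fdtop V'))).
(* The tolerance is a positive complex number, hence real; half of it goes to each of the two
   parts. *)
move=> /= e; rewrite ltcE /= => /andP[/eqP ei er].
have {ei} -> : e = ((complex.Re e)%:C)%C by case: e ei er => a b /= ->.
have e20 : 0 < complex.Re e / 2 by rewrite divr_gt0.
have [d1 d1_gt0 d1P] := slice_integral_continuous d0 cB pE p_supp mr mI kr e20.
have [d2 d2_gt0 d2P] := slice_integral_continuous d0 cB pE p_supp mi mI ki e20.
apply/fdtop_nbhsP; exists (Num.min d1 d2) => [|xi].
  by rewrite lt_min d1_gt0.
rewrite lt_min => /andP[/d1P xi1 /d2P xi2]; rewrite distrC.
apply: complex_norm_lt.
- rewrite /hybrid_transform /cintegral /=.
  under eq_Rintegral do rewrite Re_mul_int.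
  under [X in _ - X]eq_Rintegral do rewrite Re_mul_int.
  exact: xi1.
- rewrite /hybrid_transform /cintegral /=.
  under eq_Rintegral do rewrite Im_mul_int.
  under [X in _ - X]eq_Rintegral do rewrite Im_mul_int.
  exact: xi2.
Qed.

Lemma hybrid_local_compact (kappa : R -> R[i]) (phi : V -> int) (xi0 : V') :
  clocally_integrable kappa -> PL_constructible phi ->
  compact (supp phi : set (fdtop V)) ->
  hybrid_domain kappa phi xi0 /\
  {for xi0, continuous (hybrid_transform kappa phi : fdtop V' -> R[i]^o)}.
Proof.
move=> kloc phiPL /fdtop_compact_bounded[r Sr].
have [c c0 cP] := hom_norm_bound V.
(* Bounds |xi x| for [x] in the support and [xi] within distance 1 of [xi0]. *)
pose T := c * (`|v2r xi0| + 1) * `|r|.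
apply: (@hybrid_local _ _ _ 1 `[- T, T]%classic (fun=> r)) => //.
- by apply: clocally_integrable_compact => //; exact: segment_compact.
- move=> xi xid x xS; rewrite /= in_itv/= -ler_norml (le_trans (cP _ _))//.
  rewrite /T ler_pM ?mulr_ge0 ?(ltW c0)//; last first.
    by rewrite (le_trans (Sr _ xS))// ler_norm.
  apply: ler_wpM2l; first exact: ltW.
  rewrite -[v2r xi](subrK (v2r xi0)) (le_trans (ler_normD _ _))// addrC.
  by rewrite lerD2l ltW.
- by move=> _ xi _ x xS _; exact: Sr.
Qed.

(** The sign [s] treats both half-lines at once: 1 for the polar of [C], -1 for that of its
    antipode. *)
Lemma hybrid_local_cone (kappa : R -> R[i]) (phi : V -> int) (xi0 : V')
    (K C : set V) (s d e : R) :
  clocally_integrable kappa -> PL_constructible phi ->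
  compact (K : set (fdtop V)) -> supp phi `<=` [set x + y | x in K & y in C] ->
  `|s| = 1 -> 0 < d -> 0 < e ->
  (forall xi : V', `|v2r xi - v2r xi0| < d ->
     forall x, C x -> e * `|v2r x| <= s * (xi x : R)) ->
  (forall T, measurable [set t | - T <= s * t] /\
     cintegrable [set t | - T <= s * t] kappa) ->
  hybrid_domain kappa phi xi0 /\
  {for xi0, continuous (hybrid_transform kappa phi : fdtop V' -> R[i]^o)}.
Proof.
move=> kloc phiPL /fdtop_compact_bounded[r Kr] suppKC s1 d0 e0 coercive kint.
have [c c0 cP] := hom_norm_bound V.
pose T := c * (`|v2r xi0| + d) * `|r|.
have KT (xi : V') x : `|v2r xi - v2r xi0| < d -> K x -> `|xi x : R| <= T.
  move=> xid xK; rewrite (le_trans (cP _ _))//.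
  rewrite /T ler_pM ?mulr_ge0 ?(ltW c0)//; last first.
    by rewrite (le_trans (Kr _ xK))// ler_norm.
  apply: ler_wpM2l; first exact: ltW.
  rewrite -[v2r xi](subrK (v2r xi0)) (le_trans (ler_normD _ _))// addrC.
  by rewrite lerD2l ltW.
(* The compact part costs at most [T] and the conic part grows linearly. This confines the values to
   a half-line, and |xi| <= n forces the norm of [y] to be at most [(n + T) / e]. *)
have lower (xi : V') x y : `|v2r xi - v2r xi0| < d -> K x -> C y ->
    e * `|v2r y| - T <= s * (xi (x + y) : R).
  move=> xid xK yC; rewrite linearD mulrDr addrC.
  apply: lerD; last exact: coercive.
  have : `|s * (xi x : R)| <= T by rewrite normrM s1 mul1r; exact: KT.
  by rewrite ler_norml => /andP[].
have [mI iI] := kint T.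
apply: (@hybrid_local _ _ _ d _ (fun n => `|r| + (n%:R + T) / e)
  kloc phiPL d0 mI iI).
- move=> xi xid _ /suppKC[x xK [y yC <-]] /=.
  apply: le_trans (lower _ _ _ xid xK yC).
  by rewrite lerBrDr addrC subrr mulr_ge0// ltW.
- move=> n xi xid _ /suppKC[x xK [y yC <-]] xyn.
  rewrite linearD (le_trans (ler_normD _ _))// lerD//.
    by rewrite (le_trans (Kr _ xK))// ler_norm.
  rewrite ler_pdivlMr// mulrC -lerBlDr (le_trans (lower _ _ _ xid xK yC))//.
  by rewrite (le_trans (ler_norm _))// normrM s1 mul1r.
Qed.

End HybridTransform.

Theorem proposition4p1 (R : realType) (V : vectType R)
    (V_gt0 : (0 < \dim {:V})%N)
    (kappa : R -> R[i]) (kappa_loc : clocally_integrable kappa)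
    (phi : V -> int) (phi_PL : PL_constructible phi) :
  (compact (supp phi : set (fdtop V)) ->
     hybrid_domain kappa phi = setT /\
     continuous (hybrid_transform kappa phi : fdtop 'Hom(V, R^o) -> R[i]^o))
  /\
  (forall K C : set V,
     convex_set (K : set (convex_lmodType V)) ->
     compact (K : set (fdtop V)) ->
     C !=set0 -> C <> [set 0] ->
     closed (C : set (fdtop V)) ->
     convex_set (C : set (convex_lmodType V)) ->
     cone C ->
     supp phi `<=` [set x + y | x in K & y in C] ->
     (cintegrable `[0, +oo[%classic kappa ->
        let D : set (fdtop 'Hom(V, R^o)) :=
          interior (polar C : set (fdtop 'Hom(V, R^o))) in
        D `<=` hybrid_domain kappa phi /\
        {within D, continuous
           (hybrid_transform kappa phi : fdtop 'Hom(V, R^o) -> R[i]^o)})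
     /\
     (cintegrable `]-oo, 0]%classic kappa ->
        let D : set (fdtop 'Hom(V, R^o)) :=
          interior (polar (antipodal C) : set (fdtop 'Hom(V, R^o))) in
        D `<=` hybrid_domain kappa phi /\
        {within D, continuous
           (hybrid_transform kappa phi : fdtop 'Hom(V, R^o) -> R[i]^o)})).
Proof.
split.
  move=> cS; have loc xi := hybrid_local_compact xi kappa_loc phi_PL cS.
  split; last by move=> xi; exact: (loc xi).2.
  by apply/seteqP; split => // xi _; exact: (loc xi).1.
move=> K C _ cK _ _ _ _ _ suppKC; split => kint D.
- have loc (xi0 : 'Hom(V, R^o)) : D xi0 -> hybrid_domain kappa phi xi0 /\
      {for xi0, continuous
        (hybrid_transform kappa phi : fdtop 'Hom(V, R^o) -> R[i]^o)}.
    move=> /interior_polar_coercive[d [e [d0 e0 coercive]]].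
    apply: (@hybrid_local_cone _ _ _ _ _ K C 1 d e) => //.
    + by rewrite normr1.
    + by move=> xi xid x xC; rewrite mul1r; exact: coercive.
    move=> T; have -> : [set t : R | - T <= 1 * t] = `[- T, +oo[%classic.
      by apply/seteqP; split => t /=; rewrite in_itv/= mul1r andbT.
    split => //.
    (* Local integrability covers the bounded interval and the hypothesis the half-line. An
       inclusion is used rather than an equality because [T] may be negative. *)
    apply: (@cintegrableS _ _ _
      (`[- T, 0]%classic `|` `[0, +oo[%classic)) => //.
    - exact: measurableU.
    - move=> t /=; rewrite !in_itv/= !andbT => ->.
      by case: (leP t 0) => t0; [left|right; exact: ltW].
    - apply: cintegrable_setU => //.
      exact: clocally_integrable_compact (@segment_compact _ _ _).
  split; first by move=> xi /loc[].
  by apply: continuous_in_subspaceT => xi; rewrite inE => /loc[].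
- have loc (xi0 : 'Hom(V, R^o)) : D xi0 -> hybrid_domain kappa phi xi0 /\
      {for xi0, continuous
        (hybrid_transform kappa phi : fdtop 'Hom(V, R^o) -> R[i]^o)}.
    move=> /interior_polar_antipodal_coercive[d [e [d0 e0 coercive]]].
    apply: (@hybrid_local_cone _ _ _ _ _ K C (-1) d e) => //.
    + by rewrite normrN1.
    + by move=> xi xid x xC; rewrite mulN1r; exact: coercive.
    (* With sign -1 the values are bounded above, so the half-line is the one on which [kappa] is
       integrable up to a bounded interval. *)
    move=> T; have -> : [set t : R | - T <= -1 * t] = `]-oo, T]%classic.
      by apply/seteqP; split => t /=; rewrite in_itv/= mulN1r lerN2.
    split => //.
    apply: (@cintegrableS _ _ _ (`]-oo, 0]%classic `|` `[0, T]%classic)) => //.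
    - exact: measurableU.
    - move=> t /=; rewrite !in_itv/= => ->; rewrite andbT.
      by case: (leP t 0) => t0; [left|right; exact: ltW].
    - apply: cintegrable_setU => //.
      exact: clocally_integrable_compact (@segment_compact _ _ _).
  split; first by move=> xi /loc[].
  by apply: continuous_in_subspaceT => xi; rewrite inE => /loc[].
Qed.
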